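(* Let $J=\|\cdot\|^2$ on $\mathbb{R}^n$, let $f_i\colon\mathbb{R}^n\to(-\infty,+\infty]$, $i\in I=\{1,\dots,m\}$, be proper, lower semicontinuous and $\rho_i$-weakly convex with $\rho_i\ge0$, let $\mathcal{A}=\{x\in\mathbb{R}^n\mid f_i(x)\le0\text{ for all }i\in I\}$ and $J^*=\inf_{x\in\mathcal{A}}J(x)$. Let $\varepsilon>0$ be such that for every $\varepsilon_1\in(0,\varepsilon)$ one has $\mathcal{A}\cap\{x\in\mathbb{R}^n\mid J(x)=J^*+\varepsilon_1\}\ne\varnothing$. Assume that the Inexact cutting spheres algorithm with parameter $\varepsilon$ (described in the context) terminates at an iterate $x_{\bar k}$ such that $I(x_{\bar k})=\varnothing$. Then $x_{\bar k}$ is an $\varepsilon$-solution to the problem of minimizing $J$ over $\mathcal{A}$, i.e. $x_{\bar k}\in\mathcal{A}$ and $J(x_{\bar k})\le J^*+\varepsilon$.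
   Context: A function $f$ is $\rho$-weakly convex ($\rho\ge0$) if $f+\frac{\rho}{2}\|\cdot\|^2$ is convex. For $\widetilde{x}$ with $f_i(\widetilde{x})<+\infty$, $\partial_{\rm lsc}f_i(\widetilde{x})$ is the set of functions $\varphi(x)=-a\|x\|^2+\langle b,x\rangle$ with $a\ge\rho_i/2$, $b\in\mathbb{R}^n$, such that $f_i(x)-f_i(\widetilde{x})\ge\varphi(x)-\varphi(\widetilde{x})$ for all $x$. Set $L_i(\varphi,\widetilde{x})(x)=\varphi(x)+f_i(\widetilde{x})-\varphi(\widetilde{x})$ and $I(x)=\{i\in I\mid f_i(x)>0\}$. In the algorithm, for each $i$ a constant $a_i\geq\rho_i/2$, $a_i>0$, is fixed and all chosen subgradients of $f_i$ have the form $\varphi_i^k(x)=-a_i\|x\|^2+\langle b_{i,k},x\rangle$; write $L_i(\varphi_i^k,x_k)(x)=-a_i\|x\|^2+\langle b_{i,k},x\rangle+c_{i,k}$. Inexact cutting spheres algorithm: $x_0=0$, $r_0=0$, $\mathcal{O}_{-1}=\mathbb{R}^n$, $\varepsilon>0$; $m_k$ is a cost attached to iteration $k$ before it is performed, $m_0=0$, and $\overline{m}>0$ is a bound on this cost. For $k=0,1,2,\dots$: if $I(x_k)=\varnothing$ or $m_k>\overline{m}$, stop. Otherwise choose $\varphi_i^k\in\partial_{\rm lsc}f_i(x_k)$ for $i\in I(x_k)$, set $\mathcal{O}_k=\{x\mid L_i(\varphi_i^k,x_k)(x)\le0\ \forall i\in I(x_k)\}\cap\mathcal{O}_{k-1}$,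 let $\alpha_k=J(x_k)$, $\mathcal{S}_{\alpha_k}=\{x\mid\|x\|^2=\alpha_k\}$ and $\mathcal{O}_k^{\alpha_k}=\{x\mid \langle b_{i,p},x\rangle\le a_i\alpha_k-c_{i,p}\ \ \forall p\in\{r_k,\dots,k\},\ \forall i\in I(x_p)\}$, and: 1. if $\mathcal{S}_{\alpha_k}\cap\mathcal{O}_k^{\alpha_k}\ne\varnothing$, take $x_{k+1}$ in this set and put $r_{k+1}=r_k$; 2. otherwise take any $x_{k+1}$ with $J(x_{k+1})=\alpha_k+\varepsilon$, put $r_{k+1}=k+1$, and redefine $\mathcal{O}_k=\{x\mid\|x\|\ge\|x_{k+1}\|\}$ ($k+1$ is then a restart iteration). *)

(* Defs.v *)
From mathcomp Require Import all_boot all_order all_algebra.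
From mathcomp Require Import all_classical all_reals all_analysis.

Set Implicit Arguments.
Unset Strict Implicit.
Unset Printing Implicit Defensive.

Import Order.TTheory GRing.Theory Num.Theory.
Import numFieldNormedType.Exports.

Local Open Scope classical_set_scope.
Local Open Scope ring_scope.

Definition dotp (R : realType) (n : nat) (u v : 'rV[R]_n) : R :=
  \sum_(j < n) u 0 j * v 0 j.

(* The library norm on 'rV[R]_n is the sup norm, hence a separate definition;
   the two norms induce the same topology. *)
Definition enorm (R : realType) (n : nat) (u : 'rV[R]_n) : R :=
  Num.sqrt (dotp u u).

Definition J (R : realType) (n : nat) (x : 'rV[R]_n) : R := enorm x ^+ 2.

Definition proper_fun (R : realType) (n : nat) (f : 'rV[R]_n -> \bar R) : Prop :=
  (forall x, (-oo < f x)%E) /\ (exists x, (f x < +oo)%E).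

(* Meant for functions that never take the value -oo, where no undetermined
   sum occurs; the library convention 0 * +oo = 0 makes t = 0, 1 harmless. *)
Definition econvex (R : realType) (n : nat) (f : 'rV[R]_n -> \bar R) : Prop :=
  forall (x y : 'rV[R]_n) (t : R), 0 <= t <= 1 ->
    (f (t *: x + (1 - t) *: y)%R <= t%:E * f x + (1 - t)%:E * f y)%E.

Definition weakly_convex (R : realType) (n : nat) (rho : R)
    (f : 'rV[R]_n -> \bar R) : Prop :=
  econvex (fun x => (f x + (rho / 2 * enorm x ^+ 2)%:E)%E).

Definition quad (R : realType) (n : nat) (a : R) (b : 'rV[R]_n)
    (x : 'rV[R]_n) : R :=
  - a * enorm x ^+ 2 + dotp b x.

(* Empty when xt is outside the domain of f. *)
Definition lsc_subdiff (R : realType) (n : nat) (rho : R)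
    (f : 'rV[R]_n -> \bar R) (xt : 'rV[R]_n) : set ('rV[R]_n -> R) :=
  [set phi | (f xt < +oo)%E /\
    exists (a : R) (b : 'rV[R]_n), [/\ rho / 2 <= a, phi = quad a b &
      forall x, ((phi x - phi xt)%:E <= f x - f xt)%E]].

(* L(phi, xt); used only where f xt is finite. *)
Definition linearization (R : realType) (n : nat) (f : 'rV[R]_n -> \bar R)
    (phi : 'rV[R]_n -> R) (xt x : 'rV[R]_n) : R :=
  phi x + fine (f xt) - phi xt.

Definition feasible (R : realType) (n m : nat)
    (f : 'I_m -> 'rV[R]_n -> \bar R) : set 'rV[R]_n :=
  [set x | forall i, (f i x <= 0)%E].

Definition active (R : realType) (n m : nat)
    (f : 'I_m -> 'rV[R]_n -> \bar R) (x : 'rV[R]_n) : set 'I_m :=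
  [set i | (0 < f i x)%E].

Definition optval (R : realType) (n m : nat)
    (f : 'I_m -> 'rV[R]_n -> \bar R) : \bar R :=
  ereal_inf [set (J x)%:E | x in feasible f].

(* The data produced by the inexact cutting spheres algorithm; only the
   entries up to the terminating iteration are meaningful.  The set written
   O_{k-1} in the algorithm is [outer k], so that O_{-1} is [outer 0]. *)
Record run (R : realType) (n m : nat) := Run {
  iterate : nat -> 'rV[R]_n;
  restart : nat -> nat;
  slope : 'I_m -> nat -> 'rV[R]_n;
  outer : nat -> set 'rV[R]_n;
  cost : nat -> R
}.

Definition subgrad (R : realType) (n m : nat) (a : 'I_m -> R)
    (s : run R n m) (i : 'I_m) (k : nat) : 'rV[R]_n -> R :=
  quad (a i) (slope s i k).

(* c_{i,k}, the constant term of the linearization of f i at iterate k. *)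
Definition offset (R : realType) (n m : nat) (f : 'I_m -> 'rV[R]_n -> \bar R)
    (a : 'I_m -> R) (s : run R n m) (i : 'I_m) (k : nat) : R :=
  fine (f i (iterate s k)) - subgrad a s i k (iterate s k).

Definition sphere (R : realType) (n : nat) (alpha : R) : set 'rV[R]_n :=
  [set x | enorm x ^+ 2 = alpha].

(* O_k^{alpha} *)
Definition polyhedron (R : realType) (n m : nat)
    (f : 'I_m -> 'rV[R]_n -> \bar R) (a : 'I_m -> R) (s : run R n m)
    (k : nat) (alpha : R) : set 'rV[R]_n :=
  [set x | forall p : nat, (restart s k <= p <= k)%N ->
    forall i, active f (iterate s p) i ->
      dotp (slope s i p) x <= a i * alpha - offset f a s i p].

Definition stops (R : realType) (n m : nat) (f : 'I_m -> 'rV[R]_n -> \bar R)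
    (mbar : R) (s : run R n m) (k : nat) : Prop :=
  active f (iterate s k) = set0 \/ mbar < cost s k.

Definition step (R : realType) (n m : nat) (f : 'I_m -> 'rV[R]_n -> \bar R)
    (rho a : 'I_m -> R) (eps : R) (s : run R n m) (k : nat) : Prop :=
  let alpha := J (iterate s k) in
  let cand := sphere alpha `&` polyhedron f a s k alpha in
  (forall i, active f (iterate s k) i ->
     lsc_subdiff (rho i) (f i) (iterate s k) (subgrad a s i k)) /\
  ([/\ cand !=set0, cand (iterate s k.+1), restart s k.+1 = restart s k &
       outer s k.+1 =
         [set x | forall i, active f (iterate s k) i ->
            linearization (f i) (subgrad a s i k) (iterate s k) x <= 0]
         `&` outer s k]
   \/
   [/\ cand = set0, J (iterate s k.+1) = alpha + eps, restart s k.+1 = k.+1 &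
       outer s k.+1 = [set x | enorm (iterate s k.+1) <= enorm x]]).

Definition terminates_at (R : realType) (n m : nat)
    (f : 'I_m -> 'rV[R]_n -> \bar R) (rho a : 'I_m -> R) (eps mbar : R)
    (s : run R n m) (kbar : nat) : Prop :=
  [/\ iterate s 0 = 0, restart s 0 = 0%N, outer s 0 = setT & cost s 0 = 0] /\
  (forall k, (k < kbar)%N ->
     ~ stops f mbar s k /\ step f rho a eps s k) /\
  stops f mbar s kbar.

(* Main.v *)
(** Feasible points at level J(x_k) satisfy every cut collected so far, so an
    empty intersection of the sphere with the polyhedron means that the level
    set {J = J(x_k)} misses the feasible set.  Under the hypothesis on epsilon,
    and because J attains its infimum on the closed feasible set, no level in
    [J*, J* + epsilon) is missed; hence a restart only happens while
    J(x_k) < J*, and J(x_k) < J* + epsilon holds at every iteration. *)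

Require Import Defs.
From mathcomp Require Import all_boot all_order all_algebra.
From mathcomp Require Import all_classical all_reals all_analysis.
From mathcomp Require Import lra.
Import Order.TTheory GRing.Theory Num.Theory.
Import numFieldNormedType.Exports.
Local Open Scope classical_set_scope.
Local Open Scope ring_scope.

Lemma J_dotp (R : realType) (n : nat) (x : 'rV[R]_n) : J x = dotp x x.
Proof.
by rewrite /J /enorm sqr_sqrtr// sumr_ge0// => j _; rewrite -expr2 sqr_ge0.
Qed.

Lemma J_ge0 (R : realType) (n : nat) (x : 'rV[R]_n) : 0 <= J x.
Proof. exact: sqr_ge0. Qed.

Lemma coord_sqr_le_J (R : realType) (n : nat) (x : 'rV[R]_n) (j : 'I_n) :
  x 0 j ^+ 2 <= J x.
Proof.
rewrite J_dotp /dotp (bigD1 j)//= -expr2 lerDl sumr_ge0// => i _.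
by rewrite -expr2 sqr_ge0.
Qed.

Lemma continuous_J (R : realType) (n : nat) : continuous (@J R n).
Proof.
move=> x; rewrite /continuous_at (_ : @J R n = fun y => dotp y y); last first.
  by apply/funext => y; exact: J_dotp.
rewrite /dotp; apply: (cvg_big (@add_continuous R^o) (nbhs_filter x)) => j _.
by apply: cvgM; exact: coord_continuous.
Qed.

Lemma closed_feasible (R : realType) (n m : nat) (f : 'I_m -> 'rV[R]_n -> \bar R) :
  (forall i, lower_semicontinuous (f i)) -> closed (feasible f).
Proof.
move=> f_lsc; rewrite (_ : feasible f =
  \bigcap_(i in [set: 'I_m]) ~` [set x | (0%:E < f i x)%E]); last first.
  apply/seteqP; split=> x fx i => [_ /=|]; first by apply/negP; rewrite -leNgt.
  by have /negP := fx i I; rewrite -leNgt.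
apply: closed_bigI => i _; apply: open_closedC.
exact: ((lower_semicontinuousP (f i)).1 (f_lsc i)).
Qed.

Lemma compact_sublevel_J (R : realType) (n : nat) (c : R) :
  compact [set x : 'rV[R]_n | J x <= c].
Proof.
(* The half-width [c + 1] avoids a square root: [t ^+ 2 <= c] gives
   [|t| <= (t ^+ 2 + 1) / 2 <= c + 1]. *)
have cpt : compact [set v : 'rV[R]_n | forall i, v ord0 i \in `[- (c + 1), c + 1]].
  apply: (@rV_compact _ _ (fun=> `[- (c + 1), c + 1]%classic)) => _.
  exact: segment_compact.
apply: subclosed_compact cpt _.
  apply: (@preimage_closed _ _ (@J R n) [set y | y <= c]); last exact: closed_le.
  by move=> x _; exact: continuous_J.
move=> x /= xc i; have := le_trans (coord_sqr_le_J _ _ x i) xc.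
by rewrite in_itv/=; move: (x 0 i) => t tc; apply/andP; split; nra.
Qed.

Lemma optval_attained (R : realType) (n m : nat)
    (f : 'I_m -> 'rV[R]_n -> \bar R) :
  (forall i, lower_semicontinuous (f i)) -> feasible f !=set0 ->
  exists2 x, feasible f x & optval f = (J x)%:E.
Proof.
move=> f_lsc [z fz].
(* The feasible set may be unbounded, so [J] is minimized over its part below the level of one
   feasible point [z]; feasible points above that level cannot do better. *)
have cpt : compact (feasible f `&` [set x | J x <= J z]).
  rewrite setIC; apply: compact_closedI; first exact: compact_sublevel_J.
  exact: closed_feasible.
have K0 : feasible f `&` [set x | J x <= J z] !=set0 by exists z; split => /=.
have cJ := continuous_subspaceT (@continuous_J R n).
have [x /set_mem[fx xz] xmin] := EVT_min_rV K0 cpt (cJ _).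
exists x => //; apply/eqP; rewrite eq_le; apply/andP; split.
  by apply: ereal_inf_lbound; exists x.
apply: le_ereal_inf_tmp => _ [y fy <-]; rewrite lee_fin.
have [yz|/ltW zy] := leP (J y) (J z); last exact: le_trans xz zy.
by apply: xmin; apply/mem_set.
Qed.

(** The subgradient inequality bounds each linearization at [x] by [f i x <= 0]. On the sphere
    through [x] its quadratic term is the constant [- a i * J x], which turns this bound into the
    affine cut. *)
Lemma feasible_polyhedron (R : realType) (n m : nat)
    (f : 'I_m -> 'rV[R]_n -> \bar R) (rho a : 'I_m -> R) (s : run R n m)
    (k : nat) (x : 'rV[R]_n) :
  (forall i, proper_fun (f i)) ->
  (forall p, (p <= k)%N -> forall i, active f (iterate s p) i ->
     lsc_subdiff (rho i) (f i) (iterate s p) (subgrad a s i p)) ->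
  feasible f x -> polyhedron f a s k (J x) x.
Proof.
move=> f_proper sub fx p /andP[_ pk] i act.
have [fp_fin [_ [_ [_ _ /(_ x)]]]] := sub p pk i act.
have := fx i; have := (f_proper i).1 x; rewrite /offset.
move: act fp_fin; rewrite /active /=.
(* Both values are real: the one at the iterate is positive and below [+oo], the one at [x] is above
   [-oo] and at most 0. *)
case: (f i (iterate s p)) => [u| |]//= _ _; case: (f i x) => [v| |]//= _.
rewrite -EFinB !lee_fin /subgrad /quad -!/(J _); lra.
Qed.


Theorem proposition8p6 (R : realType) (n m : nat)
    (f : 'I_m -> 'rV[R]_n -> \bar R) (rho a : 'I_m -> R) (eps mbar : R)
    (s : run R n m) (kbar : nat)
    (f_proper : forall i, proper_fun (f i))
    (f_lsc : forall i, lower_semicontinuous (f i))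
    (rho_ge0 : forall i, 0 <= rho i)
    (f_wconvex : forall i, weakly_convex (rho i) (f i))
    (a_ge : forall i, rho i / 2 <= a i)
    (a_gt0 : forall i, 0 < a i)
    (eps_gt0 : 0 < eps)
    (mbar_gt0 : 0 < mbar)
    (level_feasible : forall eps1 : R, 0 < eps1 < eps ->
       feasible f `&` [set x | (J x)%:E = (optval f + eps1%:E)%E] !=set0)
    (s_run : terminates_at f rho a eps mbar s kbar)
    (s_end : active f (iterate s kbar) = set0) :
  feasible f (iterate s kbar) /\ ((J (iterate s kbar))%:E <= optval f + eps%:E)%E.
Proof.
have [init [steps _]] := s_run.
split.
  move=> i; rewrite leNgt; apply/negP => fi.
  by have : active f (iterate s kbar) i by []; rewrite s_end.
have f_feas : feasible f !=set0.
  have [|x [fx _]] := level_feasible (eps / 2); last by exists x.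
  by rewrite divr_gt0//= ltr_pdivrMr// ltr_pMr// ltr1n.
(* Attainment supplies the level [e1 = 0], which [level_feasible] leaves out. *)
have [xopt f_xopt optE] := optval_attained R n m f f_lsc f_feas.
have level e1 : 0 <= e1 < eps -> exists2 x, feasible f x & J x = J xopt + e1.
  rewrite le_eqVlt => /andP[/orP[/eqP <- _|e1_gt0 e1_lt]].
    by exists xopt; rewrite ?addr0.
  have [|x [fx /=]] := level_feasible e1; first by rewrite e1_gt0.
  by rewrite optE -EFinD => -[Jx]; exists x.
rewrite optE -EFinD lee_fin.
(* The inequality is strict because [level] says nothing about the gap [eps] itself. *)
suff bound k : (k <= kbar)%N -> J (iterate s k) < J xopt + eps.
  exact/ltW/bound.
elim: k => [_|k IH k_lt].
  have [-> _ _ _] := init.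
  rewrite (_ : J 0 = 0) ?ltr_wpDl ?J_ge0// J_dotp /dotp big1// => j _.
  by rewrite mxE mul0r.
have {}IH := IH (ltnW k_lt).
have [_ [_ [[_ [cand _] _ _]|[cand0 -> _ _]]]] := steps k k_lt.
  (* Without a restart the next iterate stays on the same sphere. *)
  by rewrite [ltLHS]cand.
(* A restart adds exactly [eps], so it must start strictly below [J xopt]; otherwise [IH] puts the
   gap in the range of [level], and the feasible point found there lies in the empty candidate
   set. *)
rewrite ltrD2r ltNge; apply/negP => opt_le.
have [|x fx Jx] := level (J (iterate s k) - J xopt).
  by rewrite subr_ge0 opt_le ltrBlDl.
have {}Jx : J x = J (iterate s k) by rewrite Jx addrC subrK.
suff : (@set0 'rV[R]_n) x by [].
rewrite -cand0; split; first exact: Jx.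
rewrite -Jx; apply: feasible_polyhedron => // p pk.
by have [_ [sub _]] := steps p (leq_ltn_trans pk k_lt); exact: sub.
Qed.
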